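(* Let $f, d_1,\dots,d_m:\mathbb{R}^n\to\mathbb{R}^n$, $d(\mathbf{x})=[d_1(\mathbf{x}),\dots,d_m(\mathbf{x})]\in\mathbb{R}^{n\times m}$, $\Xi\subseteq\mathbb{R}^m$, samples $\boldsymbol{\xi}_1,\dots,\boldsymbol{\xi}_N\in\Xi$ ($N\ge1$), $\epsilon>0$, $r>0$, $\beta\in(0,1)$, and a differentiable function $V:\mathbb{R}^n\to\mathbb{R}$ be given, and set $\dot V(\mathbf{x},\boldsymbol{\xi})=\nabla V(\mathbf{x})^\top(f(\mathbf{x})+d(\mathbf{x})\boldsymbol{\xi})$ and $G(\mathbf{x},\boldsymbol{\xi})=\dot V(\mathbf{x},\boldsymbol{\xi})+\epsilon\|\mathbf{x}\|_2^2$. Let $\mathcal{M}_N^r$ be the ball of radius $r$ in the $1$-Wasserstein distance (with the $L_1$ norm on $\Xi$ as metric) centered at the empirical distribution of the samples. Assume $\beta\le\frac1N$. Consider the condition $$\text{(A)}\quad \sup_{\mathbb{P}\in\mathcal{M}_N^r}\ \inf_{t\in\mathbb{R}}\left[\mathbb{E}_{\mathbb{P}}\big[(G(\mathbf{x},\boldsymbol{\xi})+t)_+\big]-t\beta\right]\le 0\quad\text{for all }\mathbf{x}\in\mathbb{R}^n,\ \mathbf{x}\ne\mathbf{0}.$$ Then the following condition is sufficient for (A): $$\text{(B)}\quad r\max_{1\le j\le m}\left|\nabla V(\mathbf{x})^\top d_j(\mathbf{x})\right|+\max_{1\le i\le N}\beta\left(\dot V(\mathbf{x},\boldsymbol{\xi}_i)+\epsilon\|\mathbf{x}\|_2^2\right)\le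 0\quad\text{for all }\mathbf{x}\in\mathbb{R}^n,\ \mathbf{x}\ne\mathbf{0}.$$ If $\Xi=\mathbb{R}^m$, then (B) is equivalent to (A). Also, if $f$ and $d_1,\dots,d_m$ are polynomial (and $V$ is a polynomial), then (B) is implied by the following sum-of-squares conditions (for both choices of the sign $\pm$): $$\pm\, r\,\nabla V(\mathbf{x})^\top d_j(\mathbf{x})-\beta\left(\dot V(\mathbf{x},\boldsymbol{\xi}_i)+\epsilon\|\mathbf{x}\|_2^2\right)\in\mathrm{SOS}(\mathbf{x}),\qquad i=1,\dots,N,\ j=1,\dots,m.$$
   Context: The setting is the uncertain dynamical system $\dot{\mathbf{x}}=f(\mathbf{x})+\sum_{i=1}^m d_i(\mathbf{x})\xi_i=f(\mathbf{x})+d(\mathbf{x})\boldsymbol{\xi}$ with state $\mathbf{x}\in\mathbb{R}^n$ and uncertain parameter $\boldsymbol{\xi}\in\Xi\subseteq\mathbb{R}^m$. Standing assumptions: $f$ and the $d_i$ are locally Lipschitz, $f(\mathbf{0})=\mathbf{0}$, and $\Xi$, with its metric (here $(\boldsymbol\xi,\boldsymbol\xi')\mapsto\|\boldsymbol\xi-\boldsymbol\xi'\|_1$), is a complete separable metric space with its Borel $\sigma$-algebra. $\mathcal{P}_1(\Xi)$ is the set of Borel probability measures on $\Xi$ with finite first moment. The $1$-Wasserstein distance between $\mu,\nu\in\mathcal{P}_1(\Xi)$ is $W_1(\mu,\nu)=\inf_{\gamma\in\mathbb{Q}(\mu,\nu)}\int_{\Xi\times\Xi}\|x-y\|_1\,\mathrm{d}\gamma(x,y)$,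 where $\mathbb{Q}(\mu,\nu)$ is the set of measures on $\Xi\times\Xi$ with marginals $\mu$ and $\nu$. The empirical distribution is $\hat{\mathbb{P}}_N=\frac1N\sum_{i=1}^N\delta_{\boldsymbol{\xi}_i}$, and $\mathcal{M}_N^r=\{\mu\in\mathcal{P}_1(\Xi): W_1(\mu,\hat{\mathbb{P}}_N)\le r\}$. In (A), $\mathbb{E}_{\mathbb{P}}$ is the expectation over $\boldsymbol{\xi}\sim\mathbb{P}$. For a scalar $y$, $(y)_+:=\max(y,0)$. $\mathrm{SOS}(\mathbf{x})$ denotes the set of sum-of-squares polynomials in $\mathbf{x}$, i.e., polynomials that can be written as a finite sum $\sum_k s_k(\mathbf{x})^2$ with $s_k$ real polynomials. *)

(* Defs.v *)
From HB Require Import structures.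
From mathcomp Require Import all_boot all_order all_algebra.
From mathcomp Require Import all_classical all_reals all_analysis.

Set Implicit Arguments.
Unset Strict Implicit.
Unset Printing Implicit Defensive.

Import Order.TTheory GRing.Theory Num.Theory.
Import numFieldNormedType.Exports.

Local Open Scope classical_set_scope.
Local Open Scope ring_scope.

(* The library's norm on matrices is the sup norm. *)
Definition l1norm (R : realType) (k : nat) (v : 'cV[R]_k) : R :=
  \sum_(i < k) `|v i 0|.

Definition l2norm (R : realType) (k : nat) (v : 'cV[R]_k) : R :=
  Num.sqrt (\sum_(i < k) v i 0 ^+ 2).

Definition dotcv (R : realType) (k : nat) (u v : 'cV[R]_k) : R :=
  (u^T *m v) 0 0.

Definition grad (R : realType) (n : nat) (V : 'cV[R]_n -> R) (x : 'cV[R]_n) :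
    'cV[R]_n :=
  \col_i 'D_(delta_mx i 0 : 'cV[R]_n) V x.

Definition locally_lipschitz (R : realType) (n : nat)
    (f : 'cV[R]_n -> 'cV[R]_n) : Prop :=
  forall x : 'cV[R]_n, exists2 U : set 'cV[R]_n, nbhs x U & [lipschitz f z | z in U].

(* Since the index set is nonempty, using [F ord0] as the initial value makes
   this the maximum of the values, whatever their signs. *)
Definition maxord (R : realType) (k : nat) (F : 'I_k.+1 -> R) : R :=
  \big[Num.max/F ord0]_(i < k.+1) F i.

Section UncertaintySpace.
Context (R : realType) (m : nat) (Xi : set 'cV[R]_m).

(* Xi as a metric space of its own for the L1 distance, with its Borel
   sigma-algebra. The proof [Xi0] only serves the requirement of the library
   that measurable types be pointed. *)
Definition uspace (Xi0 : Xi !=set0) : Type := {x : 'cV[R]_m | x \in Xi}.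

Variable Xi0 : Xi !=set0.

Definition uvec (z : uspace Xi0) : 'cV[R]_m := sval z.

Definition l1dist (y z : uspace Xi0) : R := l1norm (uvec y - uvec z).

Lemma l1distxx y : l1dist y y = 0.
Proof.
by rewrite /l1dist subrr /l1norm big1 // => i _; rewrite mxE normr0.
Qed.

Lemma l1dist_positivity y z : l1dist y z = 0 -> y = z.
Proof.
move=> /eqP; rewrite psumr_eq0; last by move=> i _; exact: normr_ge0.
move=> /allP h; apply: val_inj; apply/matrixP => i j.
rewrite (ord1 j); have := h i (mem_index_enum i).
by rewrite !mxE /= normr_eq0 subr_eq0 => /eqP.
Qed.

Lemma l1dist_sym y z : l1dist y z = l1dist z y.
Proof. by apply: eq_bigr => i _; rewrite !mxE distrC. Qed.

Lemma l1dist_triangle y x z : l1dist x z <= l1dist x y + l1dist y z.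
Proof.
rewrite /l1dist /l1norm -big_split /=; apply: ler_sum => i _.
by rewrite !mxE ler_distD.
Qed.

HB.instance Definition _ := Choice.copy (uspace Xi0) {x : 'cV[R]_m | x \in Xi}.
HB.instance Definition _ := isPointed.Build (uspace Xi0)
  (exist _ (sval (cid Xi0)) (mem_set (svalP (cid Xi0)))).
HB.instance Definition _ := isMetric.Build R (uspace Xi0)
  l1distxx l1dist_positivity l1dist_sym l1dist_triangle.
HB.instance Definition _ := Measurable.copy (uspace Xi0)
  (g_sigma_algebraType (@open (uspace Xi0))).

Definition complete_space : Prop :=
  forall F : set_system (uspace Xi0), ProperFilter F -> cauchy F -> cvg F.

Definition separable_space : Prop :=
  exists2 D : set (uspace Xi0), countable D & dense D.

Definition P1 : set (probability (uspace Xi0) R) :=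
  [set P | ('E_P[fun z => l1norm (uvec z)] < +oo)%E].

(* [uspace Xi0 * uspace Xi0] carries the product sigma-algebra; for separable Xi
   it is the Borel sigma-algebra of the product. *)
Definition couplings (mu nu : probability (uspace Xi0) R) :
    set {measure set (uspace Xi0 * uspace Xi0) -> \bar R} :=
  [set gamma | forall A : set (uspace Xi0), measurable A ->
    gamma (A `*` setT) = mu A /\ gamma (setT `*` A) = nu A].

Definition W1 (mu nu : probability (uspace Xi0) R) : \bar R :=
  ereal_inf [set (\int[gamma]_z (l1dist z.1 z.2)%:E)%E
            | gamma in couplings mu nu].

Section Empirical.
Context (N : nat) (xi : 'I_N.+1 -> uspace Xi0).

Definition empirical (A : set (uspace Xi0)) : \bar R :=
  ((N.+1%:R^-1)%:E * \sum_(i < N.+1) \d_(xi i) A)%E.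

Let mu : {measure set (uspace Xi0) -> \bar R} :=
  mscale (NngNum (eqbRL (invr_ge0 _) (ler0n R N.+1)))
    (msum (fun k => \d_(xi (inord k))) N.+1).

Let empiricalE : empirical = mu.
Proof.
apply/funext => A; rewrite /empirical /= /mscale /msum /=; congr (_ * _)%E.
by apply: eq_bigr => i _; rewrite inord_val.
Qed.

Let empirical0 : empirical set0 = 0%E.
Proof. by rewrite empiricalE measure0. Qed.

Let empirical_ge0 A : (0 <= empirical A)%E.
Proof. by rewrite empiricalE measure_ge0. Qed.

Let empirical_sigma_additive : semi_sigma_additive empirical.
Proof. by rewrite empiricalE; exact: measure_semi_sigma_additive. Qed.

HB.instance Definition _ := isMeasure.Build _ _ _ empirical
  empirical0 empirical_ge0 empirical_sigma_additive.

Let empiricalT : empirical setT = 1%E.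
Proof.
rewrite /empirical (eq_bigr (fun=> 1%:E)) => [|i _]; last exact: probability_setT.
by rewrite sumEFin -EFinM big_const_ord iter_addr addr0 mulVf // pnatr_eq0.
Qed.

HB.instance Definition _ :=
  Measure_isProbability.Build _ _ _ empirical empiricalT.

Definition W1ball (r : R) : set (probability (uspace Xi0) R) :=
  [set P | P1 P /\ (W1 P empirical <= r%:E)%E].

End Empirical.

Context (n : nat) (f : 'cV[R]_n -> 'cV[R]_n) (d : 'I_m -> 'cV[R]_n -> 'cV[R]_n)
  (V : 'cV[R]_n -> R).

Definition dmx (x : 'cV[R]_n) : 'M[R]_(n, m) := \matrix_(i, j) d j x i 0.

Definition Vdot (x : 'cV[R]_n) (z : uspace Xi0) : R :=
  dotcv (grad V x) (f x + dmx x *m uvec z).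

Definition Gfun (eps : R) (x : 'cV[R]_n) (z : uspace Xi0) : R :=
  Vdot x z + eps * l2norm x ^+ 2.

End UncertaintySpace.

(* The notations and [isMeasure] of mpoly clash with MathComp-Analysis.
   [mpoly n R] is the ring written {mpoly R[n]} in Multinomials. *)
From mathcomp Require Import -(notations) mpoly.

Definition polynomial_fun (R : realType) (n : nat) (h : 'cV[R]_n -> R) : Prop :=
  exists p : mpoly n R, forall x : 'cV[R]_n, h x = meval (fun i => x i 0) p.

Definition is_sos (R : realType) (n : nat) (p : mpoly n R) : Prop :=
  exists s : seq (mpoly n R), p = \sum_(q <- s) q ^+ 2.

(* Polynomials over R are identified with the functions they define. *)
Definition SOS (R : realType) (n : nat) : set ('cV[R]_n -> R) :=
  [set h | exists2 p : mpoly n R,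
             is_sos p & forall x : 'cV[R]_n, h x = meval (fun i => x i 0) p].

(* Main.v *)
Require Import Defs.
From HB Require Import structures.
From mathcomp Require Import all_boot all_order all_algebra.
From mathcomp Require Import all_classical all_reals all_analysis.
From mathcomp Require Import measurable_realfun.

(** Fix a nonzero state [x] and write [G z] for [Gfun f d V eps x z].  As a
    function of the uncertainty, [G] is affine with slopes
    [c j = dotcv (grad V x) (d j x)]; since the sup norm is dual to the
    L1 norm, it is Lipschitz for the L1 distance with constant
    [L = max_j |c j|], and on the whole space this slope is realised along a
    coordinate axis.  Let [M] be the largest value of [G] on the samples.  The
    point is that the left-hand side of the condition (B) at [x], namely
    [r * L + beta * M], bounds the worst-case value in (A), and equals it when
    the uncertainty is unconstrained.

    Upper bound ([scaled_cvar_le]).  Take [t = - M] in the infimum.  The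
    positive part of [G - M] vanishes on the samples and is [L]-Lipschitz, so
    by the easy half of Kantorovich duality ([integral_le_W1]: integrate the
    Lipschitz inequality against a coupling) its mean under any law of the
    ball is at most [L * r].

    Lower bound ([scaled_cvar_ge]).  Each sample has weight
    [1 / N.+1 >= beta], so a mass [beta] can be taken from the worst sample
    and moved over a distance [r / beta] in the direction of steepest ascent
    of [G].  The cost is [r], so the new law stays in the ball
    ([transport_from_sample]).  At the new point [G] is [M + L * r / beta], and
    the atom there alone gives a mean of at least
    [beta * (M + L * r / beta + t)] to the positive part of [G + t];
    subtracting [t * beta] leaves [beta * M + L * r], whatever [t].

    The sum-of-squares conditions imply (B) because sums of squares are
    nonnegative, and a bound on both [c j] and [- c j] is a bound on [|c j|]. *)

Set Implicit Arguments.
Unset Strict Implicit.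
Unset Printing Implicit Defensive.

Import Order.TTheory GRing.Theory Num.Theory.
Import numFieldNormedType.Exports.

Local Open Scope classical_set_scope.
Local Open Scope ring_scope.

(** * Maxima over finite index sets *)

Section Maxord.
Context (R : realType) (k : nat) (F : 'I_k.+1 -> R).

Lemma maxord_ge i : F i <= maxord F.
Proof. exact: le_bigmax. Qed.

Lemma maxord_attained : exists i, maxord F = F i.
Proof.
have /bigmax_geP[|[i _]] := lexx (maxord F).
  by move=> h; exists ord0; apply/le_anti; rewrite h maxord_ge.
by move=> h; exists i; apply/le_anti; rewrite h maxord_ge.
Qed.

End Maxord.

(** * The L1 norm and its duality with the sup norm *)

Section L1Norm.
Context (R : realType).

Lemma l1norm_ge0 k (v : 'cV[R]_k) : 0 <= l1norm v.
Proof. exact: sumr_ge0. Qed.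

Lemma coord_le_l1norm k (v : 'cV[R]_k) i : `|v i 0| <= l1norm v.
Proof. by rewrite /l1norm (bigD1 i) //= lerDl sumr_ge0. Qed.

Lemma l1norm_delta k (i : 'I_k) a :
  l1norm (a *: delta_mx i 0 : 'cV[R]_k) = `|a|.
Proof.
rewrite /l1norm (bigD1 i) //= !mxE !eqxx mulr1 big1 ?addr0 // => j /negPf ji.
by rewrite !mxE ji mulr0 normr0.
Qed.

Lemma holder_l1 k (c : 'I_k.+1 -> R) (v : 'cV[R]_k.+1) :
  `|\sum_j c j * v j 0| <= maxord (fun j => `|c j|) * l1norm v.
Proof.
rewrite (le_trans (ler_norm_sum _ _ _)) // mulr_sumr ler_sum // => j _.
by rewrite normrM ler_wpM2r // (maxord_ge (fun j => `|c j|)).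
Qed.

End L1Norm.

(** * Measurability on the uncertainty space *)

Section Measurability.
Context (R : realType) (m : nat) (Xi : set 'cV[R]_m) (Xi0 : Xi !=set0).

Lemma l1dist_ge0 (y z : uspace Xi0) : 0 <= l1dist y z.
Proof. exact: l1norm_ge0. Qed.

(** Lipschitz functions are continuous, hence Borel. *)
Lemma lipschitz_uspace_measurable (h : uspace Xi0 -> R) (L : R) :
  (forall y z, `|h y - h z| <= L * l1dist y z) -> measurable_fun setT h.
Proof.
move=> hL.
have hc : continuous h.
  move=> y; apply/(@cvgrPdist_lt _ _ _ _ (nbhs_filter y)) => e e0.
  (* [L] may be nonpositive; [`|L| + 1] is a positive constant above it. *)
  have L0 : 0 < `|L| + 1 by rewrite ltr_wpDl.
  apply/nbhs_ballP; exists (e / (`|L| + 1)); first exact: divr_gt0.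
  move=> z; rewrite ballEmdist /= ltr_pdivlMr // => yz.
  apply: le_lt_trans yz; rewrite (le_trans (hL _ _)) // mulrC.
  by rewrite ler_wpM2l ?l1dist_ge0 // ler_wpDr // ler_norm.
apply: (measurability _ (RGenOpens.measurableE R)) => _ [_ [a [b ->] <-]].
rewrite setTI; apply: sub_sigma_algebra.
by apply: open_comp => [? _|]; [exact: hc|exact: interval_open].
Qed.

Lemma measurable_uvec j : measurable_fun setT (fun z : uspace Xi0 => uvec z j 0).
Proof.
apply: (@lipschitz_uspace_measurable _ 1) => y z; rewrite mul1r.
by have := coord_le_l1norm (uvec y - uvec z) j; rewrite !mxE.
Qed.

Lemma measurable_l1norm :
  measurable_fun setT (fun z : uspace Xi0 => l1norm (uvec z)).
Proof.
apply: measurable_sum => j; apply: measurableT_comp => //.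
exact: measurable_uvec.
Qed.

(** The product carries the product sigma-algebra, so continuity of the
    distance does not give this directly; the coordinates do, as each of them
    is a Borel function composed with a projection. *)
Lemma measurable_l1dist :
  measurable_fun setT (fun z : uspace Xi0 * uspace Xi0 => l1dist z.1 z.2).
Proof.
rewrite (_ : (fun _ => _) = (fun z : uspace Xi0 * uspace Xi0 =>
    \sum_(j < m) `|uvec z.1 j 0 - uvec z.2 j 0|)); last first.
  by apply/funext => z; apply: eq_bigr => j _; rewrite !mxE.
apply: measurable_sum => j; apply: measurableT_comp => //.
by apply: measurable_funB;
  [apply: (measurableT_comp (measurable_uvec j) measurable_fst)
  |apply: (measurableT_comp (measurable_uvec j) measurable_snd)].
Qed.

End Measurability.

(** * Finite combinations of Dirac masses *)

Section Atomic.
Context d (T : measurableType d) (R : realType).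

Definition atomic (K : nat) (w : nat -> {nonneg R}) (p : nat -> T) :
    set T -> \bar R :=
  msum (fun k => mscale (w k) \d_(p k)) K.

HB.instance Definition _ K w p := Measure.on (atomic K w p).

Lemma atomicE K w p A :
  atomic K w p A = (\sum_(k < K) (w k)%:num * (p k \in A)%:R)%:E.
Proof.
by rewrite /atomic /msum -sumEFin; apply: eq_bigr.
Qed.

Lemma integral_atomic K w p (h : T -> R) :
  measurable_fun setT h -> (forall z, 0 <= h z) ->
  (\int[atomic K w p]_z (h z)%:E = (\sum_(k < K) (w k)%:num * h (p k))%:E)%E.
Proof.
move=> /measurable_EFinP mh h0.
rewrite ge0_integral_measure_sum //; last by move=> z _; rewrite lee_fin.
rewrite -sumEFin; apply: eq_bigr => k _.
rewrite ge0_integral_mscale //; last by move=> z _; rewrite lee_fin.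
by rewrite integral_dirac // diracT mul1e.
Qed.

End Atomic.

(** * Couplings and the Wasserstein distance *)

Section Wasserstein.
Context (R : realType) (m : nat) (Xi : set 'cV[R]_m) (Xi0 : Xi !=set0).
Local Notation U := (uspace Xi0).

Section Coupling.
Context (mu nu : probability U R) (gamma : {measure set (U * U) -> \bar R}).
Hypothesis mu_nu : couplings mu nu gamma.

Lemma integral_fst_coupling (h : U -> \bar R) :
  measurable_fun setT h -> (forall z, 0 <= h z)%E ->
  (\int[mu]_z h z = \int[gamma]_z h z.1)%E.
Proof.
move=> mh h0; transitivity (\int[pushforward gamma fst]_z h z)%E; last first.
  by rewrite (ge0_integral_pushforward measurable_fst) // preimage_setT.
apply: eq_measure_integral => A mA _; apply: etrans (esym (mu_nu mA).1) _.
by have -> : A `*` [set: U] = fst @^-1` A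
  by apply/seteqP; split=> [[? ?] [] //|[? ?]].
Qed.

Lemma integral_snd_coupling (h : U -> \bar R) :
  measurable_fun setT h -> (forall z, 0 <= h z)%E ->
  (\int[nu]_z h z = \int[gamma]_z h z.2)%E.
Proof.
move=> mh h0; transitivity (\int[pushforward gamma snd]_z h z)%E; last first.
  by rewrite (ge0_integral_pushforward measurable_snd) // preimage_setT.
apply: eq_measure_integral => A mA _; apply: etrans (esym (mu_nu mA).2) _.
by have -> : [set: U] `*` A = snd @^-1` A
  by apply/seteqP; split=> [[? ?] [] //|[? ?]].
Qed.

(** Both integrals can be taken against the coupling, where the Lipschitz
    inequality holds pointwise. *)
Lemma integral_le_coupling (h : U -> R) (L : R) :
  measurable_fun setT h -> (forall z, 0 <= h z) -> 0 <= L ->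
  (forall y z, h y <= h z + L * l1dist y z) ->
  (\int[mu]_z (h z)%:E <= \int[nu]_z (h z)%:E +
     L%:E * \int[gamma]_z (l1dist z.1 z.2)%:E)%E.
Proof.
move=> mh h0 L0 hL.
have /measurable_EFinP mhE := mh.
have /measurable_EFinP mdE := @measurable_l1dist R m Xi Xi0.
rewrite integral_fst_coupling // integral_snd_coupling //.
have dist0 (z : U * U) : (0 <= (l1dist z.1 z.2 : R)%:E)%E.
  by rewrite lee_fin l1dist_ge0.
have mh1 := measurableT_comp mhE (@measurable_fst _ _ U U).
have mh2 := measurableT_comp mhE (@measurable_snd _ _ U U).
have h1_ge0 (z : U * U) : (0 <= (h z.1)%:E :> \bar R)%E by rewrite lee_fin.
have h2_ge0 (z : U * U) : (0 <= (h z.2)%:E :> \bar R)%E by rewrite lee_fin.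
have Ld_ge0 (z : U * U) : (0 <= L%:E * (l1dist z.1 z.2)%:E)%E.
  by rewrite mule_ge0.
have mLd : measurable_fun setT
    (fun z : U * U => L%:E * (l1dist z.1 z.2)%:E)%E.
  exact: (measurable_funeM L%:E mdE).
rewrite -(ge0_integralZl_EFin gamma measurableT (fun z _ => dist0 z) mdE L0).
rewrite -(ge0_integralD gamma measurableT (fun z _ => h2_ge0 z) mh2
  (fun z _ => Ld_ge0 z) mLd).
apply: (ge0_le_integral gamma measurableT (fun z _ => h1_ge0 z) mh1
  (emeasurable_funD mh2 mLd)) => z _.
by rewrite -EFinM -EFinD lee_fin.
Qed.

End Coupling.

(** The inequality of Kantorovich duality that needs no optimal coupling: a
    coupling of almost minimal cost suffices. *)
Lemma integral_le_W1 (mu nu : probability U R) (h : U -> R) (L r : R) :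
  measurable_fun setT h -> (forall z, 0 <= h z) -> 0 <= L ->
  (forall y z, h y <= h z + L * l1dist y z) -> (W1 mu nu <= r%:E)%E ->
  (\int[mu]_z (h z)%:E <= \int[nu]_z (h z)%:E + (L * r)%:E)%E.
Proof.
move=> mh h0 L0 hL Wr; apply/lee_addgt0Pr => e e0.
have L1 : 0 < L + 1 by rewrite ltr_wpDl.
(* The excess cost gets multiplied by [L], which may be zero: hence [L + 1]. *)
have : (W1 mu nu < (r + e / (L + 1))%:E)%E.
  by rewrite (le_lt_trans Wr) // lte_fin ltrDl divr_gt0.
move=> /ereal_inf_lt[_ [gamma mu_nu <-]] /ltW gamma_le.
apply: (le_trans (integral_le_coupling mu_nu mh h0 L0 hL)).
rewrite -[leRHS]addeA leeD2l // (le_trans (lee_wpmul2l _ gamma_le)) ?lee_fin //.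
rewrite mulrDr lerD2l mulrA ler_pdivrMr // mulrC ler_wpM2l ?(ltW e0) //.
by rewrite lerDl.
Qed.

Lemma W1_le_coupling (mu nu : probability U R)
    (gamma : {measure set (U * U) -> \bar R}) (c : \bar R) :
  couplings mu nu gamma -> (\int[gamma]_z (l1dist z.1 z.2)%:E <= c)%E ->
  (W1 mu nu <= c)%E.
Proof.
by move=> mu_nu; apply: le_trans; apply: ereal_inf_lbound; exists gamma.
Qed.

(** * Perturbing the empirical measure *)

Section Empirical.
Context (N : nat) (xi : 'I_N.+1 -> U).

Lemma empiricalE A :
  empirical xi A = (N.+1%:R^-1 * \sum_(i < N.+1) (xi i \in A)%:R)%:E.
Proof. by rewrite /empirical EFinM -sumEFin. Qed.

Lemma integral_empirical (h : U -> R) :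
  measurable_fun setT h -> (forall z, 0 <= h z) ->
  (\int[empirical xi]_z (h z)%:E = (N.+1%:R^-1 * \sum_(i < N.+1) h (xi i))%:E)%E.
Proof.
move=> mh h0.
pose w (k : nat) : {nonneg R} := NngNum (eqbRL (invr_ge0 _) (ler0n R N.+1)).
pose p k := xi (inord k).
rewrite (eq_measure_integral (atomic N.+1 w p)) => [|A mA _].
  rewrite integral_atomic // mulr_sumr; congr EFin.
  by apply: eq_bigr => i _; rewrite /p inord_val.
rewrite /= atomicE empiricalE mulr_sumr; congr EFin.
by apply: eq_bigr => i _; rewrite /p inord_val.
Qed.

(** The law [P] arises from the empirical measure by moving the mass [b] from
    the sample [xi i0] to [y].  The condition [b <= 1 / N.+1] says that this
    sample has enough mass.  The coupling that moves nothing else has cost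
    [b * l1dist y (xi i0)], and the integral bound retains only the new atom. *)
Lemma transport_from_sample (i0 : 'I_N.+1) (y : U) (b : R) :
  0 <= b -> b <= 1 / N.+1%:R ->
  exists P : probability U R,
    [/\ P1 P,
        (W1 P (empirical xi) <= (b * l1dist y (xi i0))%:E)%E &
        forall h : U -> R, measurable_fun setT h -> (forall z, 0 <= h z) ->
          ((b * h y)%:E <= \int[P]_z (h z)%:E)%E].
Proof.
rewrite div1r => b0 bN; pose c : R := N.+1%:R^-1.
(* The atoms are indexed by [k < N.+2]: the samples, then the moved mass. *)
pose ext (S : Type) (F : 'I_N.+1 -> S) (e : S) k :=
  if (k < N.+1)%N then F (inord k) else e.
have comp_ext S S' (g : S -> S') F e k :
  g (ext S F e k) = ext S' (g \o F) (g e) k by rewrite /ext; case: ifP.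
(* Samples may coincide, so the weight is reduced at the index [i0] only, not
   at every index of the point [xi i0]. *)
have w0 k : 0 <= ext R (fun i => c - b *+ (i == i0)) b k.
  rewrite /ext; case: ifP => // _; case: (_ == _).
    by rewrite mulr1n subr_ge0.
  by rewrite mulr0n subr0 invr_ge0.
pose w k : {nonneg R} := NngNum (w0 k).
have sum_w (F : 'I_N.+1 -> R) e :
    \sum_(k < N.+2) (w k)%:num * ext R F e k =
    c * (\sum_i F i) + b * (e - F i0).
  rewrite big_ord_recr /= /ext ltnn.
  rewrite (eq_bigr (fun i => c * F i - b * (F i *+ (i == i0)))); last first.
    move=> i _; rewrite /= ltn_ord inord_val mulrBl.
    by case: (i == i0); rewrite ?mulr1n ?mulr0n ?mul0r ?mulr0.
  rewrite big_split /= -mulr_sumr sumrN -mulr_sumr -addrA; congr (_ + _).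
  rewrite (bigD1 i0) //= eqxx mulr1n big1 => [|i /negPf -> //].
  by rewrite addr0 mulrBr addrC.
(* Each atom of [P] at [p k] comes from the sample [q k]. *)
pose p := ext U xi y; pose q := ext U xi (xi i0).
have p1 : atomic N.+2 w p setT = 1%E.
  rewrite atomicE; congr EFin.
  rewrite (eq_bigr (fun k : 'I__ => (w k)%:num * ext R (fun=> 1) 1 k)).
    by rewrite sum_w subrr mulr0 addr0 sumr_const card_ord mulVf ?pnatr_eq0.
  by move=> k _; rewrite in_setT /ext; case: ifP.
pose P : probability U R := HB.pack (atomic N.+2 w p)
  (Measure_isProbability.Build _ _ _ (atomic N.+2 w p) p1).
exists P; split.
- rewrite /P1 /= unlock integral_atomic ?ltry //; first exact: measurable_l1norm.
  by move=> z; exact: l1norm_ge0.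
- pose gamma : {measure set (U * U) -> \bar R} :=
    atomic N.+2 w (fun k => (p k, q k)).
  apply: (@W1_le_coupling _ _ gamma) => [A mA|].
    split; rewrite /= !atomicE ?empiricalE.
      congr EFin; apply: eq_bigr => k _; congr (_ * (nat_of_bool _)%:R).
      by apply/idP/idP; rewrite !inE //= => -[].
    rewrite -[RHS]/(c * _)%:E; congr EFin.
    transitivity (c * (\sum_i (xi i \in A)%:R) +
                  b * ((xi i0 \in A)%:R - (xi i0 \in A)%:R)).
      rewrite -sum_w; apply: eq_bigr => k _.
      rewrite -(comp_ext _ _ (fun z => (z \in A)%:R)).
      congr (_ * (nat_of_bool _)%:R).
      by apply/idP/idP; rewrite !inE //= => -[].
    by rewrite subrr mulr0 addr0.
  rewrite integral_atomic; last 2 first.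
  - exact: measurable_l1dist.
  - by move=> z; exact: l1dist_ge0.
  rewrite (eq_bigr (fun k : 'I__ =>
    (w k)%:num * ext R (fun=> 0) (l1dist y (xi i0)) k)).
    by rewrite sum_w big1 // mulr0 add0r subr0.
  by move=> k _; rewrite /p /q /ext /=; case: ifP; rewrite ?l1distxx.
- move=> h mh h0; rewrite integral_atomic // lee_fin.
  have py : p N.+1 = y by rewrite /p /ext ltnn.
  have wb : (w N.+1)%:num = b by rewrite /= /ext ltnn.
  rewrite big_ord_recr wb py lerDr.
  by apply: sumr_ge0 => k _; rewrite mulr_ge0.
Qed.

End Empirical.

End Wasserstein.

(** * The worst-case conditional value-at-risk *)

Section CVaR.
Context (R : realType) (m : nat) (Xi : set 'cV[R]_m) (Xi0 : Xi !=set0).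
Local Notation U := (uspace Xi0).

(** By the Rockafellar-Uryasev formula, for [0 < beta < 1] and [G] integrable
    under [P], this is [beta] times the conditional value-at-risk of [G] with
    tail mass [beta]. *)
Definition scaled_cvar (P : probability U R) (G : U -> R) (beta : R) :
    \bar R :=
  ereal_inf [set 'E_P[fun z => (Num.max (G z + t) 0)%R] - (t * beta)%:E
            | t in [set: R]]%E.

Context (N : nat) (xi : 'I_N.+1 -> U) (r beta : R) (G : U -> R).
Hypothesis mG : measurable_fun setT G.

Let mpos t : measurable_fun setT (fun z => Num.max (G z + t) 0).
Proof. by apply: measurable_maxr => //; exact: measurable_funD. Qed.

Let pos_ge0 t z : 0 <= Num.max (G z + t) 0.
Proof. by rewrite le_max lexx orbT. Qed.

(** The choice [t = - M] makes the positive part of [G + t] vanish on the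
    samples, so that its mean under [P] is only what the transport from the
    empirical measure can create. *)
Lemma scaled_cvar_le (P : probability U R) (L M : R) :
  0 <= L -> (forall y z, G y <= G z + L * l1dist y z) ->
  (forall i, G (xi i) <= M) -> W1ball xi r P ->
  (scaled_cvar P G beta <= (r * L + beta * M)%:E)%E.
Proof.
move=> L0 GL GM [_ Pr].
apply: (@le_trans _ _
  ('E_P[fun z => (Num.max (G z + - M) 0)%R] - (- M * beta)%:E)%E).
  by apply: ereal_inf_lbound; exists (- M).
have posL y z : Num.max (G y - M) 0 <= Num.max (G z - M) 0 + L * l1dist y z.
  have Ld : 0 <= L * l1dist y z by rewrite mulr_ge0 ?l1dist_ge0.
  rewrite ge_max addr_ge0 // andbT -[leRHS]addrC -lerBlDl.
  by rewrite le_max lerBlDl addrA lerD2r addrC GL.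
have := integral_le_W1 (mpos (- M)) (pos_ge0 (- M)) L0 posL Pr.
rewrite integral_empirical // big1 => [|i _]; last first.
  by apply/max_idPr; rewrite subr_le0.
rewrite mulr0 add0e => EP.
rewrite unlock -EFinN EFinD; apply: leeD.
  by rewrite [r * L]mulrC.
by rewrite lee_fin mulNr opprK mulrC.
Qed.

(** The mass [beta] placed at [y] contributes [beta * (G y + t)] to the mean of
    the positive part of [G + t], and the term [t * beta] of the objective
    cancels the dependence on [t]: this is why the amount of mass moved is
    exactly [beta]. *)
Lemma scaled_cvar_ge (i0 : 'I_N.+1) (y : U) :
  0 <= beta -> beta <= 1 / N.+1%:R -> beta * l1dist y (xi i0) <= r ->
  exists2 P, W1ball xi r P & ((beta * G y)%:E <= scaled_cvar P G beta)%E.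
Proof.
move=> b0 bN yr.
have [P [P1P PW PE]] := transport_from_sample xi i0 y b0 bN.
exists P; first by split => //; rewrite (le_trans PW) ?lee_fin.
apply: le_ereal_inf_tmp => _ [t _ <-].
rewrite unlock leeBrDr // -EFinD (le_trans _ (PE _ (mpos t) (pos_ge0 t))) //.
by rewrite lee_fin [t * _]mulrC -mulrDr ler_wpM2l // le_max lexx.
Qed.

End CVaR.

(** * The derivative along trajectories as a function of the uncertainty *)

Section Dynamics.
Context (R : realType) (n m : nat) (Xi : set 'cV[R]_m.+1) (Xi0 : Xi !=set0).
Context (f : 'cV[R]_n -> 'cV[R]_n) (d : 'I_m.+1 -> 'cV[R]_n -> 'cV[R]_n).
Context (V : 'cV[R]_n -> R) (eps : R) (x : 'cV[R]_n).
Local Notation U := (uspace Xi0).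
Local Notation c j := (dotcv (grad V x) (d j x)).
Local Notation G := (Gfun f d V eps x : U -> R).

Lemma Vdot_affine (z : U) :
  Vdot f d V x z = dotcv (grad V x) (f x) + \sum_j c j * uvec z j 0.
Proof.
rewrite /Vdot /dotcv mulmxDr mulmxA !mxE; congr (_ + _).
apply: eq_bigr => j _; rewrite !mxE; congr (_ * _).
by apply: eq_bigr => i _; rewrite !mxE.
Qed.

Lemma Gfun_sub (y z : U) :
  G y - G z = \sum_j c j * (uvec y - uvec z) j 0.
Proof.
rewrite /Gfun !Vdot_affine opprD addrACA subrr addr0 opprD addrACA subrr add0r.
by rewrite -sumrB; apply: eq_bigr => j _; rewrite !mxE mulrBr.
Qed.

Lemma Gfun_lipschitz (y z : U) :
  `|G y - G z| <= maxord (fun j => `|c j|) * l1dist y z.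
Proof. by rewrite Gfun_sub holder_l1. Qed.

Lemma measurable_Gfun : measurable_fun setT G.
Proof. exact: lipschitz_uspace_measurable Gfun_lipschitz. Qed.

(** The slope is largest along a coordinate axis [j] with [`|c j|] maximal.  The
    distance is only bounded by [s] because the direction is zero, as is the
    slope, when all the [c j] vanish. *)
Lemma Gfun_steepest (z : U) (s : R) : Xi = setT -> 0 <= s ->
  exists2 y : U, l1dist y z <= s & G y = G z + maxord (fun j => `|c j|) * s.
Proof.
move=> XiT s0; have [j cj] := maxord_attained (fun j => `|c j|).
pose v : 'cV[R]_m.+1 := (Num.sg (c j) * s) *: delta_mx j 0.
have XiP u : u \in Xi by rewrite XiT in_setT.
pose y : U := exist _ (uvec z + v) (XiP _).
have yz : uvec y - uvec z = v by rewrite /uvec /= addrAC subrr add0r.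
exists y.
  rewrite /l1dist yz l1norm_delta normrM normr_sg (ger0_norm s0).
  by rewrite ler_piMl //; case: (_ == _).
apply/eqP; rewrite addrC -subr_eq; apply/eqP.
rewrite Gfun_sub yz cj (bigD1 j) //= big1 => [|i /negPf ij].
  by rewrite !mxE !eqxx mulr1 addr0 mulrA [c j * _]mulrC -normrEsg.
by rewrite !mxE ij !mulr0.
Qed.

End Dynamics.

(** * Sums of squares and the equivalence *)

Lemma SOS_ge0 (R : realType) (n : nat) (h : 'cV[R]_n -> R) (x : 'cV[R]_n) :
  SOS h -> 0 <= h x.
Proof.
move=> [_ [s ->] ->].
rewrite (big_morph _ (mpoly.mevalD _) (mpoly.meval0 _)) sumr_ge0 // => q _.
by rewrite expr2 mpoly.mevalM -expr2 sqr_ge0.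
Qed.

Theorem proposition2 (R : realType) (n m N : nat)
  (f : 'cV[R]_n -> 'cV[R]_n) (d : 'I_m.+1 -> 'cV[R]_n -> 'cV[R]_n)
  (Xi : set 'cV[R]_m.+1) (Xi0 : Xi !=set0) (xi : 'I_N.+1 -> uspace Xi0)
  (eps r beta : R) (V : 'cV[R]_n -> R)
  (f_lip : locally_lipschitz f) (d_lip : forall j, locally_lipschitz (d j))
  (f0 : f 0 = 0)
  (Xi_complete : complete_space Xi0) (Xi_separable : separable_space Xi0)
  (eps_gt0 : 0 < eps) (r_gt0 : 0 < r) (beta_gt0 : 0 < beta) (beta_lt1 : beta < 1)
  (V_diff : forall x : 'cV[R]_n, differentiable V x)
  (beta_le : beta <= 1 / N.+1%:R) :
  let A := forall x : 'cV[R]_n, x != 0 ->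
    (ereal_sup [set ereal_inf
                  [set 'E_P[fun z => (Num.max (Gfun f d V eps x z + t) 0)%R]
                       - (t * beta)%:E | t in [set: R]]
               | P in W1ball xi r] <= 0)%E in
  let B := forall x : 'cV[R]_n, x != 0 ->
    r * maxord (fun j => `|dotcv (grad V x) (d j x)|)
    + maxord (fun i => beta * (Vdot f d V x (xi i) + eps * l2norm x ^+ 2)) <= 0 in
  [/\ B -> A,
      Xi = setT -> (B <-> A) &
      (forall i, polynomial_fun (fun x => f x i 0)) ->
      (forall j i, polynomial_fun (fun x => d j x i 0)) ->
      polynomial_fun V ->
      (forall i j,
         SOS (fun x => r * dotcv (grad V x) (d j x)
                - beta * (Vdot f d V x (xi i) + eps * l2norm x ^+ 2)) /\
         SOS (fun x => - (r * dotcv (grad V x) (d j x))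
                - beta * (Vdot f d V x (xi i) + eps * l2norm x ^+ 2))) ->
      B].
Proof.
move=> A B.
pose c x j := dotcv (grad V x) (d j x).
pose L x := maxord (fun j => `|c x j|).
have L0 x : 0 <= L x by rewrite (le_trans _ (maxord_ge _ ord0)).
have mG x := measurable_Gfun (Xi0 := Xi0) f d V eps x.
have BA : B -> A.
  move=> Bx x x0; apply/ereal_supP => _ [P Pr <-].
  have [i0 maxE] := maxord_attained (fun i => beta * Gfun f d V eps x (xi i)).
  apply: (@le_trans _ _ (r * L x + beta * Gfun f d V eps x (xi i0))%:E).
    apply: scaled_cvar_le Pr => // [y z|i].
      rewrite -lerBlDl.
      exact: le_trans (ler_norm _) (Gfun_lipschitz _ _ _ _ _ _ _).
    rewrite -(ler_pM2l beta_gt0) -maxE.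
    exact: (maxord_ge (fun i => beta * Gfun f d V eps x (xi i))).
  by rewrite lee_fin -maxE; exact: Bx.
split=> //.
- move=> XiT; split=> // Ax x x0.
  have [i0 maxE] := maxord_attained (fun i => beta * Gfun f d V eps x (xi i)).
  (* The mass [beta] can travel this far with the budget [r]. *)
  have rb0 : 0 <= r / beta by rewrite divr_ge0 ?ltW.
  have [y yd Gy] := Gfun_steepest f d V eps x (xi i0) XiT rb0.
  have yr : beta * l1dist y (xi i0) <= r by rewrite mulrC -ler_pdivlMr.
  have [P Pr] := scaled_cvar_ge (mG x) (ltW beta_gt0) beta_le yr.
  have -> : beta * Gfun f d V eps x y =
      r * L x + maxord (fun i => beta * Gfun f d V eps x (xi i)).
    rewrite Gy maxE mulrDr addrC mulrCA [beta * (r / beta)]mulrC.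
    by rewrite divfK ?gt_eqF // [L x * _]mulrC.
  move=> lb; rewrite -lee_fin; apply: (le_trans lb).
  by apply: le_trans (Ax x x0); apply: ereal_sup_ubound; exists P.
- move=> _ _ _ sos x x0.
  have [j ->] := maxord_attained (fun j => `|c x j|).
  have [i ->] := maxord_attained
    (fun i => beta * (Vdot f d V x (xi i) + eps * l2norm x ^+ 2)).
  have [/(SOS_ge0 x) sosp /(SOS_ge0 x) sosn] := sos i j.
  rewrite -(gtr0_norm r_gt0) -normrM.
  by case: (ger0P (r * c x j)) => _; rewrite -oppr_ge0 opprD // opprK.
Qed.
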